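(* Let $k\ge 1$ be an integer. Then there exists $N_k$ such that $c_k(n)\ge 0$ for all $n\ge N_k$. Moreover, $N_k$ can be given explicitly.
   Context: $Q(n)$ denotes the number of partitions of $n$ into distinct parts (with $Q(0)=1$). $T_j:=j(j+1)/2$ is the $j$th triangular number. $(-q;q)_\infty:=\prod_{j\ge 1}(1+q^j)$, which is the generating function of $Q(n)$. The sequences $c_k(n)$, $n\ge 0$, are defined by $c_1(n):=Q(n)$ and, for $k\ge 2$, by the generating function $$\sum_{n=0}^\infty c_k(n)q^n= (-1)^{k-1}(-q;q)_\infty\left((-1)^{k-1}q^{T_{2(k-1)}}+\sum_{j=0}^{k-2} (-1)^j\left(q^{T_{2j}}-q^{T_{2j+1}}\right)\right).$$ *)

(* Defs.v *)
From HB Require Import structures.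
From mathcomp Require Import all_boot all_order all_algebra.

Set Implicit Arguments.
Unset Strict Implicit.
Unset Printing Implicit Defensive.

Import Order.TTheory GRing.Theory Num.Theory.
Local Open Scope ring_scope.

(* A partition of n into distinct parts is a finite set of positive integers
   with sum n; all parts are at most n, and i : 'I_n stands for the part i+1. *)
Definition Q (n : nat) : nat :=
  #|[set A : {set 'I_n} | (\sum_(i in A) i.+1 == n)%N]|.

Definition T (j : nat) : nat := ((j * j.+1)./2)%N.

(* Formal power series in q over int, as coefficient sequences. *)
Definition series : Type := nat -> int.

Definition series_mul (f g : series) : series :=
  fun n => \sum_(i < n.+1) f i * g (n - i)%N.

Definition series_of_poly (p : {poly int}) : series := fun n => p`_n.

(* The product of (1 + q^j) over all j >= 1: the factors with j > n do not
   affect the coefficient of q^n (see qprodE). *)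
Definition qprod : series :=
  fun n => (\prod_(1 <= j < n.+1) (1 + 'X^j) : {poly int})`_n.

Lemma qprodE (n m : nat) : (n <= m)%N ->
  qprod n = (\prod_(1 <= j < m.+1) (1 + 'X^j) : {poly int})`_n.
Proof.
move=> /subnKC <-; elim: (m - n)%N => [|d IHd]; first by rewrite addn0.
rewrite addnS big_nat_recr //= mulrDr mulr1 coefD coefMXn.
by rewrite ltnS leq_addr addr0.
Qed.

Lemma qprod_Q (n : nat) : qprod n = (Q n)%:Z.
Proof.
rewrite /qprod big_add1 /= big_mkord.
under eq_bigr do rewrite addrC.
rewrite bigA_distr /= coef_sum /Q -sum1_card -natz natr_sum /=.
rewrite [RHS]big_mkcond /=; apply: eq_bigr => A _.
rewrite -big_mkcond /= prodrXr coefXn inE eq_sym.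
by case: eqP.
Qed.

(* The factor multiplying (-1)^(k-1) (-q;q)_oo in the generating function. *)
Definition trunc_theta (k : nat) : {poly int} :=
  (-1) ^+ k.-1 * 'X^(T (2 * k.-1)%N)
  + \sum_(0 <= j < k.-1) (-1) ^+ j * ('X^(T (2 * j)%N) - 'X^(T (2 * j).+1%N)).

(* The value at k = 0 is irrelevant. *)
Definition c (k : nat) : series :=
  if k == 1%N then fun n => (Q n)%:Z
  else fun n =>
    (-1) ^+ k.-1 * series_mul qprod (series_of_poly (trunc_theta k)) n.

(* Closed-form expressions in one natural number variable, used to express
   that a bound depending on k is given by an explicit formula in k. *)
Inductive formula : Type :=
| Var
| Const of nat
| Add of formula & formula
| Mul of formula & formula
| Pow of formula & formula.

Fixpoint eval (e : formula) (k : nat) : nat :=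
  match e with
  | Var => k
  | Const a => a
  | Add e1 e2 => (eval e1 k + eval e2 k)%N
  | Mul e1 e2 => (eval e1 k * eval e2 k)%N
  | Pow e1 e2 => (eval e1 k ^ eval e2 k)%N
  end.

(* Main.v *)
Require Import Defs.
From HB Require Import structures.
From mathcomp Require Import all_boot all_order all_algebra.
From mathcomp Require Import ring zify.

Set Implicit Arguments.
Unset Strict Implicit.
Unset Printing Implicit Defensive.

Import Order.TTheory GRing.Theory Num.Theory.
Local Open Scope ring_scope.

(** The polynomial factor in the generating function of c_k is 1 at q = 1, so c_k(n) is
    asymptotic to Q(n) as soon as Q(n - 1) / Q(n) tends to 1.  Precisely, with
    m = k - 1, c_k(n) is Q(n - T_(2m)) plus a signed sum of the differences
    Q(n - T_(2j)) - Q(n - T_(2j+1)), j < m.  Since Q is nondecreasing, these are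
    nonnegative differences over disjoint intervals, so whatever the signs their
    sum is at least -(Q(n) - Q(n - T_(2m))).  Hence c_k(n) >= 0 as soon as
    Q(n) <= 2 Q(n - T_(2m)) (lemma c_ge0).

    It remains to show Q(n) <= 2 Q(n - d) for n large in terms of d
    (Q_le_double).  The difference D(n) = Q(n) - Q(n - 1) counts the
    distinct partitions of n whose two largest parts are consecutive integers
    (QS).  An argument of Bateman and Erdos bounds D(n).  Deleting one
    part, other than the two largest, from such a partition leaves a partition
    of the same kind of a smaller integer, and the deleted part is recovered
    from the two weights.  If most partitions counted by D(n) have at least t
    further parts this gives t D(n) <= D(1) + ... + D(n - 1) <= Q(n); those
    with fewer than t further parts are polynomially many, so
      t D(n) <= Q(n) + t^2 n^(t+1)     (Qdiff_bound).
    On the other hand the 2^s subsets of {1, ..., s} all have weight at most s^2,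
    which forces Q(n) to grow faster than any power of n, with an explicit
    threshold (Q_superpoly).  Beyond it t D(n) <= 2 Q(n), and the choice
    t = 4 d and d such steps yield the claim. *)

(** * Distinct partitions with bounded parts *)

Definition weight (M : nat) (A : {set 'I_M}) : nat := (\sum_(i in A) i.+1)%N.

Definition bounded_Q (M n : nat) : nat := #|[set A : {set 'I_M} | weight A == n]|.

Definition qprod_upto (M : nat) : {poly int} := \prod_(1 <= j < M.+1) (1 + 'X^j).

Lemma coef_qprod_upto (M n : nat) : (qprod_upto M)`_n = (bounded_Q M n)%:Z.
Proof.
rewrite /qprod_upto big_add1 /= big_mkord.
under eq_bigr do rewrite addrC.
rewrite bigA_distr /= coef_sum /bounded_Q -sum1_card -natz natr_sum /=.
rewrite [RHS]big_mkcond /=; apply: eq_bigr => A _.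
rewrite -big_mkcond /= prodrXr coefXn inE eq_sym /weight.
by case: eqP.
Qed.

Lemma qprod_upto0 : qprod_upto 0 = 1.
Proof. by rewrite /qprod_upto big_geq. Qed.

Lemma qprod_uptoS (M : nat) :
  qprod_upto M.+1 = qprod_upto M * (1 + 'X^(M.+1)).
Proof. by rewrite /qprod_upto big_nat_recr. Qed.

Lemma bounded_Q_large (M n : nat) : (n <= M)%N -> bounded_Q M n = Q n.
Proof.
move=> leqnM; have := coef_qprod_upto M n.
by rewrite /qprod_upto -(qprodE leqnM) qprod_Q => -[].
Qed.

Lemma leq_bounded_Q (M M' n : nat) :
  (M <= M')%N -> (bounded_Q M n <= bounded_Q M' n)%N.
Proof.
move=> /subnKC <-; elim: (M' - M)%N => [|d IHd]; first by rewrite addn0.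
apply: leq_trans IHd _; rewrite addnS -lez_nat -!coef_qprod_upto qprod_uptoS.
rewrite mulrDr mulr1 coefD lerDl coefMXn.
by case: ifP; rewrite // coef_qprod_upto.
Qed.

Lemma bounded_Q_le_Q (M n : nat) : (bounded_Q M n <= Q n)%N.
Proof.
rewrite -(bounded_Q_large (leq_maxr M n)).
exact: leq_bounded_Q (leq_maxl M n).
Qed.

(** * Monotonicity of Q and the differences Q(n) - Q(n - 1) *)

(** In the limit of large m, (1 - q) (-q;q)_oo is 1 plus the generating function
    of the distinct partitions whose two largest parts i + 1 and i + 2 are
    consecutive, the other parts being at most i: for n >= 2, adding 1 to the
    largest part of a distinct partition of n - 1 gives every distinct
    partition of n except these.  The last term is the error due to truncating
    the product. *)
Lemma qprod_upto_mul1BX (m : nat) :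
  (1 - 'X) * qprod_upto m.+1 =
  1 + \sum_(i < m) 'X^(2 * i + 3)%N * qprod_upto i - 'X^(m.+2) * qprod_upto m.
Proof.
elim: m => [|m IHm].
  by rewrite qprod_uptoS qprod_upto0 big_ord0 !exprS expr0; ring.
rewrite [in LHS]qprod_uptoS mulrA IHm big_ord_recr /= [in RHS]qprod_uptoS.
have := IHm; rewrite qprod_uptoS.
set S := \sum_(i < m) _; set P := qprod_upto m => /(congr1 (fun x => x - 1 + 'X^(m.+2) * P)).
move=> E; have -> : S = (1 - 'X) * (P * (1 + 'X^(m.+1))) - 1 + 'X^(m.+2) * P.
  by rewrite E; ring.
have -> : 'X^(2 * m + 3)%N = 'X * 'X * 'X * 'X^m * 'X^m :> {poly int}.
  by rewrite mulSn mul1n !exprD !exprS expr0; ring.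
by rewrite !exprS; ring.
Qed.

(** The index i bounds the parts below the two largest, i + 1 and i + 2, whose
    sum is 2 i + 3. *)
Definition Qdiff (n : nat) : nat :=
  (\sum_(i < n | 2 * i + 3 <= n) bounded_Q i (n - (2 * i + 3)))%N.

Lemma QS (n : nat) : Q n.+1 = (Q n + Qdiff n.+1)%N.
Proof.
have /(congr1 (fun p : {poly int} => p`_n.+1)) := qprod_upto_mul1BX n.+1.
rewrite mulrBl mul1r coefB coefXM /= !coef_qprod_upto !bounded_Q_large //.
rewrite coefB coefD coef1 add0r coefXnM ltnS leqnSn subr0 coef_sum.
move=> E; apply/eqP; rewrite -eqz_nat PoszD addrC -subr_eq E; apply/eqP.
rewrite /Qdiff -natz natr_sum /= [RHS]big_mkcond /=; apply: eq_bigr => i _.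
rewrite coefXnM ltnNge coef_qprod_upto.
  by case: (_ <= _)%N; rewrite /= ?natz.
by rewrite ltnW.
Qed.

Lemma leq_Q (m n : nat) : (m <= n)%N -> (Q m <= Q n)%N.
Proof.
apply: (homo_leq (f := Q) (r := leq)) => //; first exact: leq_trans.
by move=> i; rewrite QS leq_addr.
Qed.

Lemma sum_Qdiff (n : nat) : (\sum_(i < n.+1) Qdiff i <= Q n)%N.
Proof.
elim: n => [|n IHn]; first by rewrite big_ord1 /Qdiff big_ord0.
by rewrite big_ord_recr QS leq_add2r.
Qed.

(** * Deleting a part *)

Lemma card_small_sets (M t : nat) :
  (#|[set A : {set 'I_M} | #|A| < t]| <= t * M.+1 ^ t)%N.
Proof.
elim: t => [|t IHt]; first by rewrite mul0n leqn0 cards_eq0; apply/eqP/setP => A; rewrite !inE.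
have -> : [set A : {set 'I_M} | (#|A| < t.+1)%N] =
  [set A : {set 'I_M} | (#|A| < t)%N] :|: [set A : {set 'I_M} | #|A| == t].
  by apply/setP => A; rewrite !inE ltnS leq_eqVlt orbC.
apply: leq_trans (leq_card_setU _ _) _.
rewrite card_draws card_ord mulSn addnC.
apply: leq_add.
  apply: (@leq_trans (M ^ t)%N); last first.
    apply: (@leq_trans (M.+1 ^ t)%N); last by rewrite leq_pexp2l.
    by case: (t) => // u; rewrite leq_exp2r.
  apply: (@leq_trans (M ^_ t)%N); first by rewrite -bin_ffact leq_pmulr ?fact_gt0.
  elim: t {IHt} => [|t IHt] //; rewrite ffactnSr expnSr.
  by rewrite leq_mul // leq_subr.
by apply: leq_trans IHt _; rewrite leq_mul2l leq_pexp2l ?orbT.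
Qed.

Lemma card_weight_lt (M n : nat) :
  (#|[set A : {set 'I_M} | weight A < n]| = \sum_(b < n) bounded_Q M b)%N.
Proof.
elim: n => [|n IHn].
  by rewrite big_ord0; apply/eqP; rewrite cards_eq0; apply/eqP/setP => A; rewrite !inE.
have -> : [set A : {set 'I_M} | (weight A < n.+1)%N] =
  [set A : {set 'I_M} | (weight A < n)%N] :|: [set A : {set 'I_M} | weight A == n].
  by apply/setP => A; rewrite !inE ltnS leq_eqVlt orbC.
rewrite big_ord_recr /= -IHn cardsU.
rewrite (_ : _ :&: _ = set0) ?cards0 ?subn0 //.
by apply/setP => A; rewrite !inE; case: ltngtP.
Qed.

(** A set A of weight n with a marked element i maps to A minus i, of weight
    less than n; this is injective because the missing weight determines i. *)
Lemma sum_card_weight (M n : nat) :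
  (\sum_(A : {set 'I_M} | weight A == n) #|A| <= \sum_(b < n) bounded_Q M b)%N.
Proof.
rewrite -card_weight_lt.
pose S := [set p : {set 'I_M} * 'I_M | (weight p.1 == n) && (p.2 \in p.1)].
have -> : (\sum_(A : {set 'I_M} | weight A == n) #|A| = #|S|)%N.
  under eq_bigr => A _ do rewrite -sum1_card.
  rewrite -sum1_card.
  by rewrite pair_big_dep; apply: eq_bigl => -[A i]; rewrite inE.
pose f (p : {set 'I_M} * 'I_M) := p.1 :\ p.2.
have weight_f p : p \in S -> (weight (f p) + p.2.+1 = n)%N.
  case: p => A i; rewrite inE /= => /andP[/eqP <- iA].
  by rewrite [in RHS]/weight (big_setD1 i) //= addnC.
rewrite -(card_in_imset (f := f) (D := S)); last first.
  move=> [A i] [B j] Sp Sq Efg.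
  have Eij : i = j.
    have := weight_f _ Sp; have := weight_f _ Sq.
    by rewrite Efg => <- /addnI [] /ord_inj.
  move: Sp Sq Efg; rewrite !inE /f /= Eij => /andP[_ iA] /andP[_ jB] Efg.
  by rewrite -(setD1K iA) Efg setD1K.
apply/subset_leq_card/subsetP => _ /imsetP[p Sp ->].
by rewrite inE -(weight_f _ Sp) -addSnnS leq_addr.
Qed.

(** Markov's inequality for the number of parts: the first term accounts for
    the partitions with at least t parts, the second for the others. *)
Lemma bounded_Q_bound (t M n : nat) :
  (t * bounded_Q M n <= \sum_(b < n) bounded_Q M b + t * (t * M.+1 ^ t))%N.
Proof.
apply: (@leq_trans (\sum_(A : {set 'I_M} | weight A == n) #|A| +
                    t * #|[set A : {set 'I_M} | #|A| < t]|)%N); last first.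
  by rewrite leq_add ?sum_card_weight // leq_mul2l card_small_sets orbT.
rewrite /bounded_Q -!sum1dep_card !big_distrr /= [X in (_ <= _ + X)%N]big_mkcond.
rewrite [X in (_ <= X + _)%N]big_mkcond -big_split big_mkcond /=.
apply: leq_sum => A _; case: (weight A == n) => //.
by case: ltnP; lia.
Qed.

Lemma Qdiff_widen (m n : nat) : (n <= m)%N ->
  (Qdiff n = \sum_(i < m | 2 * i + 3 <= n) bounded_Q i (n - (2 * i + 3)))%N.
Proof.
move=> lenm; rewrite /Qdiff.
rewrite (big_ord_widen_cond m (fun i => 2 * i + 3 <= n)%N
          (fun i => bounded_Q i (n - (2 * i + 3)))) //.
by apply: eq_bigl => i; lia.
Qed.

(** Summing the previous bound over i, the first terms regroup, by the weight
    left after the deletion, into differences Qdiff j with j < n, whose sum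
    telescopes. *)
Lemma Qdiff_bound (t n : nat) :
  (t * Qdiff n <= Q n + t ^ 2 * n ^ t.+1)%N.
Proof.
case: n => [|n]; first by rewrite /Qdiff big_ord0 muln0.
rewrite {1}/Qdiff big_distrr /=.
apply: (@leq_trans (\sum_(i < n.+1 | 2 * i + 3 <= n.+1)
   (\sum_(b < n.+1 - (2 * i + 3)) bounded_Q i b + t ^ 2 * n.+1 ^ t))%N).
  apply: leq_sum => i _; apply: leq_trans (bounded_Q_bound t i _) _.
  rewrite leq_add2l mulnA leq_mul2l.
  have -> : (i.+1 ^ t <= n.+1 ^ t)%N by case: (t) => // u; rewrite leq_exp2r.
  by rewrite orbT.
rewrite big_split /=; apply: leq_add; last first.
  rewrite sum_nat_const (expnS n.+1) mulnCA leq_mul2l leq_mul2r.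
  by rewrite -[X in (_ <= X)%N](card_ord n.+1) max_card !orbT.
apply: leq_trans (leq_Q (leqnSn n)); apply: leq_trans (sum_Qdiff n).
rewrite [leqRHS](eq_bigr (fun j : 'I_n.+1 => \sum_(i < n.+1 | 2 * i + 3 <= j)
    bounded_Q i (j - (2 * i + 3)))%N); last first.
  by move=> j _; rewrite (@Qdiff_widen n.+1) // ltnW.
rewrite (exchange_big_dep (fun i : 'I_n.+1 => 2 * i + 3 <= n.+1)%N) /=; last first.
  by move=> j i _ leij; apply: leq_trans leij (ltnW _).
apply: leq_sum => i _; set a := (2 * i + 3)%N.
rewrite -[leqRHS](big_mkord (fun j => a <= j)%N (fun j => bounded_Q i (j - a))).
have [lean|ltna] := leqP a n.+1; last first.
  by rewrite (eqP (ltnW ltna : _ - _ == 0)%N) big_ord0.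
rewrite (big_cat_nat (leq0n a) lean) /=.
apply: leq_trans (leq_addl _ _).
have := @big_addn nat 0%N addn 0 n.+1 a (fun j => a <= j)%N (fun j => bounded_Q i (j - a)).
rewrite add0n => ->; rewrite big_mkord.
rewrite [leqRHS](eq_bigl xpredT) => [|b]; last exact: leq_addl.
by apply: leq_sum => b _; rewrite addnK.
Qed.

(** * Growth of Q *)

(** Each of the 2^s subsets of {1, ..., s} is a distinct partition of one of
    the integers 0, ..., n, each of which has at most Q(n) of them. *)
Lemma Q_lower (s n : nat) : (s ^ 2 <= n)%N -> (2 ^ s <= n.+1 * Q n)%N.
Proof.
move=> les.
have <- : #|[set A : {set 'I_s} | (weight A < n.+1)%N]| = (2 ^ s)%N.
  rewrite -[s in RHS]card_ord -cardsT -card_powerset powersetT.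
  congr #|pred_of_set _|.
  apply/setP => A; rewrite !inE ltnS; apply: leq_trans les.
  apply: (@leq_trans (\sum_(i < s) s)%N); last by rewrite sum_nat_const card_ord.
  rewrite /weight big_mkcond /=; apply: leq_sum => i _.
  by case: ifP => // _; exact: ltn_ord.
rewrite card_weight_lt -[n.+1 in leqRHS]card_ord -sum_nat_const.
apply: leq_sum => b _; apply: leq_trans (bounded_Q_le_Q _ _) (leq_Q _).
by rewrite -ltnS.
Qed.

(** For s = w q with w = 4 (t + 4), the inequality q + 1 <= 2^q turns the lower
    bound 2^s into (q + 1)^w, which is at least (n + 1)^(t + 4) provided that
    n + 1 <= (q + 1)^4. *)
Lemma Q_superpoly (t n : nat) :
  ((4 * (t + 4)) ^ 4 <= n)%N -> (t ^ 2 * n ^ t.+1 <= Q n)%N.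
Proof.
set w := (4 * (t + 4))%N => lewn.
(* w q is the largest multiple of w whose square is at most n; the bound
   w^4 <= n makes w itself an admissible value of q. *)
have [q [lewq leqn ltnq]] :
    exists q, [/\ w <= q.+1, (w * q) ^ 2 <= n & n < (w * q.+1) ^ 2]%N.
  have ex0 : exists q, ((w * q) ^ 2 <= n)%N by exists 0%N; rewrite muln0.
  have bounded q : ((w * q) ^ 2 <= n)%N -> (q <= n)%N by nia.
  case: (ex_maxnP ex0 bounded) => q leqn maxq; exists q; split=> //.
    by apply: leqW; apply: maxq; rewrite mulnn -expnM.
  by rewrite ltnNge; apply/negP => /maxq; rewrite ltnn.
have ltn4 : (n < q.+1 ^ 4)%N.
  apply: leq_trans ltnq _; rewrite -[4%N]/(2 * 2)%N expnM leq_exp2r //.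
  by rewrite -mulnn leq_mul2r lewq orbT.
have lt2 : (n.+1 ^ (t + 4) <= 2 ^ (w * q))%N.
  apply: (@leq_trans ((q.+1 ^ 4) ^ (t + 4))%N).
    by rewrite leq_exp2r // addn4.
  rewrite -expnM -/w mulnC expnM leq_exp2r; last by rewrite /w addn4.
  exact: ltn_expl.
have lenQ := leq_trans lt2 (Q_lower leqn).
have letn : (t <= n)%N by apply: leq_trans lewn; rewrite /w; nia.
rewrite -(leq_pmul2l (ltn0Sn n)); apply: leq_trans lenQ.
rewrite (_ : t + 4 = (2 + t.+1).+1)%N; last by lia.
rewrite (expnS n.+1) leq_mul2l expnD leq_mul //.
  by rewrite leq_exp2r // ltnW.
by rewrite leq_exp2r.
Qed.

(** Over the d steps from n - d to n, each increment is at most 2 Q(n) / (4 d),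
    so the total increment is at most Q(n) / 2. *)
Lemma Q_le_double (d n : nat) :
  (d + (4 * (4 * d + 4)) ^ 4 <= n)%N -> (Q n <= 2 * Q (n - d))%N.
Proof.
case: d => [|d]; first by rewrite subn0 mul2n -addnn leq_addr.
set t := (4 * d.+1)%N => len.
have step m : (n - d.+1 <= m)%N -> (m < n)%N -> (t * Q m.+1 <= t * Q m + 2 * Q n)%N.
  move=> lem ltmn; rewrite QS mulnDr leq_add2l.
  apply: leq_trans (Qdiff_bound _ _) _.
  have leQ := leq_Q ltmn; rewrite mul2n -addnn leq_add //.
  by apply: leq_trans leQ; apply: Q_superpoly; lia.
have telescope e : (e <= d.+1)%N ->
    (t * Q (n - d.+1 + e) <= t * Q (n - d.+1) + e * (2 * Q n))%N.
  elim: e => [|e IHe] lee; first by rewrite addn0 mul0n addn0.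
  rewrite addnS; apply: leq_trans (step _ _ _) _; [lia|lia|].
  by have := IHe (ltnW lee); lia.
have := telescope d.+1 (leqnn _); rewrite subnK; last by lia.
rewrite /t; nia.
Qed.

(** * The truncated theta series *)

Lemma coef_qprod_mul (p : {poly int}) (n : nat) :
  series_mul qprod (series_of_poly p) n = (qprod_upto n * p)`_n.
Proof.
rewrite coefM; apply: eq_bigr => i _; congr (_ * _).
by rewrite (qprodE (_ : i <= n)%N) // -ltnS.
Qed.

Lemma coef_qprod_mulXn (a n : nat) : (a <= n)%N ->
  (qprod_upto n * 'X^a)`_n = (Q (n - a))%:Z.
Proof.
move=> lean; rewrite coefMXn ltnNge lean coef_qprod_upto bounded_Q_large //.
exact: leq_subr.
Qed.

Lemma TS (j : nat) : T j.+1 = (T j + j.+1)%N.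
Proof. rewrite /T; lia. Qed.

Lemma leq_T : {homo T : i j / (i <= j)%N}.
Proof.
apply: homo_leq => //; first exact: leq_trans.
by move=> i; rewrite TS leq_addr.
Qed.

Lemma coef_signM (a n : nat) (p : {poly int}) :
  ((-1) ^+ a * p)`_n = (-1) ^+ a * p`_n.
Proof.
rewrite -[in LHS]signr_odd -[in RHS]signr_odd !mulr_sign.
by case: ifP; rewrite ?coefN.
Qed.

Lemma c_expansion (m n : nat) : (T (2 * m) <= n)%N ->
  c m.+1 n = (Q (n - T (2 * m)))%:Z + \sum_(0 <= j < m)
    (-1) ^+ (m + j) * ((Q (n - T (2 * j)))%:Z - (Q (n - T (2 * j).+1))%:Z).
Proof.
case: m => [|m] leTn; first by rewrite /c /= big_geq // addr0 subn0.
rewrite /c /= coef_qprod_mul /trunc_theta /= mulrDr coefD mulrDr.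
congr (_ + _).
  by rewrite mulrCA coef_signM mulrA -expr2 sqrr_sign mul1r coef_qprod_mulXn.
rewrite mulr_sumr coef_sum mulr_sumr; apply: eq_big_nat => j /andP[_ ltjm].
rewrite exprD -mulrA; congr (_ * _).
rewrite mulrCA coef_signM mulrBr coefB.
have leT i : (i <= 2 * m.+1)%N -> (T i <= n)%N.
  by move=> /leq_T leT; apply: leq_trans leTn.
have leT0 : (T (2 * j) <= n)%N by apply: leT; lia.
have leT1 : (T (2 * j).+1 <= n)%N by apply: leT; lia.
by rewrite (coef_qprod_mulXn leT0) (coef_qprod_mulXn leT1).
Qed.

(** The worst case is that all the differences carry a minus sign; monotonicity
    of Q then bounds their sum by a telescoping one. *)
Lemma c_ge0 (m n : nat) : (T (2 * m) <= n)%N ->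
  (Q n <= 2 * Q (n - T (2 * m)))%N -> 0 <= c m.+1 n.
Proof.
move=> leTn leQ; rewrite c_expansion //.
pose q i : int := (Q (n - T i))%:Z.
have q_anti i j : (i <= j)%N -> q j <= q i.
  by move=> leij; rewrite lez_nat leq_Q // leq_sub2l // leq_T.
have telescope i : \sum_(0 <= j < i) (q (2 * j)%N - q (2 * j).+1) <= (Q n)%:Z - q (2 * i)%N.
  elim: i => [|i IHi]; first by rewrite big_geq // /q subn0 subrr.
  rewrite big_nat_recr //=.
  have leqq : q (2 * i.+1)%N <= q (2 * i).+1 by apply: q_anti; lia.
  by apply: le_trans (lerD IHi (lerB (lexx _) leqq)) _; rewrite addrA subrK.
have sign_bound : - \sum_(0 <= j < m) (q (2 * j)%N - q (2 * j).+1) <=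
    \sum_(0 <= j < m) (-1) ^+ (m + j) * (q (2 * j)%N - q (2 * j).+1).
  rewrite -sumrN; apply: ler_sum => j _; rewrite -signr_odd mulr_sign.
  have := q_anti _ _ (leqnSn (2 * j)%N).
  by case: ifP; lia.
have := telescope m; rewrite -/(q (2 * m)%N) in sign_bound *.
move: sign_bound leQ; rewrite /q; lia.
Qed.

(** The formula d + (4 (4 d + 4))^4 of Q_le_double with d = 2 k^2, a simple upper
    bound of T_(2(k-1)). *)
Definition threshold : formula :=
  Add (Mul (Const 2) (Pow Var (Const 2)))
      (Pow (Mul (Const 4) (Add (Mul (Const 8) (Pow Var (Const 2))) (Const 4)))
           (Const 4)).

Lemma c_ge0_threshold (k n : nat) :
  (1 <= k)%N -> (eval threshold k <= n)%N -> 0 <= c k n.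
Proof.
case: k => // m _ /= len.
have leT : (T (2 * m) <= 2 * m.+1 ^ 2)%N by rewrite /T -mulnn; nia.
apply: c_ge0.
  by apply: leq_trans len; apply: leq_trans leT (leq_addr _ _).
apply: (@leq_trans (2 * Q (n - 2 * m.+1 ^ 2))%N).
  apply: Q_le_double; apply: leq_trans len; rewrite leq_add2l leq_exp2r //.
  by rewrite !mulnA.
by rewrite leq_mul2l leq_Q // leq_sub2l.
Qed.

Theorem theorem1p4 :
  (forall k : nat, (1 <= k)%N ->
     exists N : nat, forall n : nat, (N <= n)%N -> 0 <= c k n) /\
  (exists e : formula, forall k : nat, (1 <= k)%N ->
     forall n : nat, (eval e k <= n)%N -> 0 <= c k n).
Proof.
have main k n := @c_ge0_threshold k n.
split; last by exists threshold => k k_gt0 n; exact: main.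
by move=> k k_gt0; exists (eval threshold k) => n; exact: main.
Qed.
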